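(* Let $(G_n)$ be a sequence of simple undirected graphs without isolated vertices, where $G=G_n$ has $n$ vertices, maximum degree $\Delta=\Delta(G_n)$, and $\frac{\Delta}{\mathrm{vol}\, G} = o(n^{-2/3})$ as $n\to\infty$. For each $G=G_n$ let $\mathcal{L}$ be the normalized Laplacian of $G$ with eigenvalues $0=\lambda_0\le\lambda_1\le\lambda_2\le\cdots\le\lambda_{n-1}$ (with multiplicity) and corresponding harmonic eigenvectors $\mathbf{v}_0,\mathbf{v}_1,\dots,\mathbf{v}_{n-1}\in\mathbb{R}^n$, where the eigenvectors $\mathbf{D}^{1/2}\mathbf{v}_0,\dots,\mathbf{D}^{1/2}\mathbf{v}_{n-1}$ of $\mathcal{L}$ are pairwise orthogonal and $\mathbf{v}_0$ is a multiple of the all-ones vector $\mathbf{1}$. Let $0<k\le n-1$ be any integer and let $\mathbf{v}$ be a real linear combination of $\mathbf{v}_1,\dots,\mathbf{v}_k$ with $\|\mathbf{D}^{1/2}\mathbf{v}\|_2=1$ and $\|\mathbf{v}\|_\infty\le\frac12$. Then the Cheeger constant $h_G$ obeys $$\frac{1}{2}-\frac{1-\lambda_1}{2}\;\le\; h_G\;\le\;\left(\frac{1}{2}-\frac{1-\lambda_k}{2\,\|\mathbf{v}\|_\infty^2\,\mathrm{vol}\, G}\right)(1+o(1)),$$ where the $o(1)$ term tends to $0$ as $n\to\infty$.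
   Context: For a graph $G=(V,E)$ (simple, unweighted, undirected, with no isolated vertices), $d_v$ denotes the degree of a vertex $v$, $\mathbf{A}$ the adjacency matrix, $\mathbf{D}$ the diagonal matrix of degrees, and $\mathcal{L} = \mathbf{I} - \mathbf{D}^{-1/2}\mathbf{A}\mathbf{D}^{-1/2}$ the normalized Laplacian. If $\mathbf{D}^{1/2}\mathbf{y}$ is an eigenvector of $\mathcal{L}$, then $\mathbf{y}$ is called a harmonic eigenvector. For $S\subseteq V$, $\mathrm{vol}\, S = \sum_{v\in S} d_v$ and $\mathrm{vol}\, G=\mathrm{vol}\, V$. $E(S,\bar S)$ is the number of edges between $S$ and its complement $\bar S = V\setminus S$. The Cheeger constant is $$h_G = \min_{\substack{S\subset V\\ 0<\mathrm{vol}\, S\le \mathrm{vol}\, G/2}} \frac{E(S,\bar S)}{\mathrm{vol}\, S}.$$ Norms: $\|\mathbf{v}\|_2=\sqrt{\sum_i \mathbf{v}_i^2}$, $\|\mathbf{v}\|_\infty=\max_i|\mathbf{v}_i|$. Asymptotic notation is as the number of vertices $n\to\infty$: $g(n)=o(f(n))$ means $\lim_{n\to\infty} g(n)/f(n)=0$. *)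

(* Defs.v *)
From HB Require Import structures.
From mathcomp Require Import all_boot all_order all_algebra.
From mathcomp Require Import all_classical all_reals all_analysis.

Set Implicit Arguments.
Unset Strict Implicit.
Unset Printing Implicit Defensive.

Import Order.TTheory GRing.Theory Num.Theory.
Import numFieldNormedType.Exports.

Local Open Scope ring_scope.

Record simple_graph (n : nat) := SimpleGraph {
  adjacent :> rel 'I_n;
  adjacent_sym : symmetric adjacent;
  adjacent_irr : irreflexive adjacent }.

Definition degree n (g : simple_graph n) (x : 'I_n) : nat := #|[pred y | g x y]|.

Definition max_degree n (g : simple_graph n) : nat :=
  (\max_(x < n) degree g x)%N.

Definition no_isolated n (g : simple_graph n) : Prop :=
  forall x, (0 < degree g x)%N.

Definition vol n (g : simple_graph n) (S : {set 'I_n}) : nat :=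
  (\sum_(x in S) degree g x)%N.

Definition volG n (g : simple_graph n) : nat := vol g [set: 'I_n].

(* Each edge between S and its complement is counted once, oriented from S. *)
Definition cut n (g : simple_graph n) (S : {set 'I_n}) : nat :=
  #|[pred p : 'I_n * 'I_n | [&& p.1 \in S, p.2 \notin S & g p.1 p.2]]|.

(* The set is finite, and nonempty as soon as 0 < n and no vertex is isolated
   (see [cheeger_min]); its infimum is then a minimum. *)
Definition cheeger (R : realType) n (g : simple_graph n) : R :=
  inf [set r : R | exists S : {set 'I_n},
    [/\ (0 < vol g S)%N,
        (vol g S)%:R <= (volG g)%:R / 2 :> R &
        r = (cut g S)%:R / (vol g S)%:R]]%classic.

Lemma degree_le_half n (g : simple_graph n) (x : 'I_n) :
  no_isolated g -> (2 * degree g x <= volG g)%N.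
Proof.
move=> g0; rewrite /volG /vol (bigD1 x) ?inE //= mul2n -addnn leq_add2l.
rewrite /degree -sum1_card (bigID (fun y => y == x)) /=.
rewrite big1 ?add0n => [|y /andP[xy /eqP yx]]; last first.
  by move: xy; rewrite yx inE adjacent_irr.
rewrite big_mkcond [leqRHS]big_mkcond /=; apply: leq_sum => y _.
rewrite inE; case: (g x y) => //=; case: eqP => //= _; rewrite finset.in_setT; exact: g0.
Qed.

Lemma cheeger_min (R : realType) n (g : simple_graph n) :
  (0 < n)%N -> no_isolated g ->
  let admissible S := (0 < vol g S)%N && (2 * vol g S <= volG g)%N in
  let ratio S : R := (cut g S)%:R / (vol g S)%:R in
  (exists2 S, admissible S & cheeger R g = ratio S) /\
  (forall S, admissible S -> cheeger R g <= ratio S).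
Proof.
move=> n0 g0 adm ratio.
have halfE (S : {set 'I_n}) : ((vol g S)%:R <= (volG g)%:R / 2 :> R) =
    (2 * vol g S <= volG g)%N.
  by rewrite ler_pdivlMr // -natrM ler_nat mulnC.
have vol1 x : vol g [set x] = degree g x by rewrite /vol big_set1.
have adm1 : adm [set Ordinal n0].
  by rewrite /adm vol1 g0 degree_le_half.
have [S admS minS] := arg_minP ratio adm1.
have [S0 S2] := andP admS.
have chS : cheeger R g = ratio S.
  apply/eqP; rewrite eq_le; apply/andP; split.
    apply: ge_inf; last by exists S; split => //; rewrite halfE.
    by exists 0 => _ [T [_ _ ->]]; rewrite divr_ge0.
  apply: lb_le_inf; first by exists (ratio S), S; split => //; rewrite halfE.
  by move=> _ [T [T0 T2 ->]]; apply: minS; rewrite /adm T0 -halfE.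
by split=> [|T admT]; [exists S | rewrite chS; exact: minS].
Qed.

Section Matrices.
Variables (R : realType) (n : nat) (g : simple_graph n).

Definition adj_mx : 'M[R]_n := \matrix_(i, j) (g i j)%:R.

Definition sqrt_deg_mx : 'M[R]_n :=
  diag_mx (\row_i Num.sqrt (degree g i)%:R).

Definition inv_sqrt_deg_mx : 'M[R]_n :=
  diag_mx (\row_i (Num.sqrt (degree g i)%:R)^-1).

Definition normalized_laplacian : 'M[R]_n :=
  1%:M - inv_sqrt_deg_mx *m adj_mx *m inv_sqrt_deg_mx.

Definition harmonic_eigenvector (a : R) (y : 'cV[R]_n) : Prop :=
  let x := sqrt_deg_mx *m y in
  x != 0 /\ normalized_laplacian *m x = a *: x.

(* As the n eigenvectors [sqrt_deg_mx *m y i] are nonzero and pairwise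
   orthogonal, they form a basis, so lam lists all the eigenvalues of the
   normalized Laplacian with multiplicity. *)
Definition harmonic_eigensystem (lam : n.-tuple R) (y : 'I_n -> 'cV[R]_n) :
    Prop :=
  [/\ sorted <=%R lam,
      lam`_0 = 0,
      forall i, harmonic_eigenvector (tnth lam i) (y i),
      forall i j, i != j ->
        (sqrt_deg_mx *m y i)^T *m (sqrt_deg_mx *m y j) = 0 &
      forall i : 'I_n, i = 0%N :> nat -> exists c : R, y i = c *: const_mx 1].

End Matrices.

Definition norm2 (R : realType) n (x : 'cV[R]_n) : R :=
  Num.sqrt (\sum_(i < n) x i ord0 ^+ 2).

Definition norm_oo (R : realType) n (x : 'cV[R]_n) : R :=
  \big[Num.max/0]_(i < n) `|x i ord0|.

(* Main.v *)
Require Import Defs.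
From HB Require Import structures.
From mathcomp Require Import all_boot all_order all_algebra.
From mathcomp Require Import all_classical all_reals all_analysis.
From mathcomp Require Import zify ring lra.

Set Implicit Arguments.
Unset Strict Implicit.
Unset Printing Implicit Defensive.

Import Order.TTheory GRing.Theory Num.Theory.
Import numFieldNormedType.Exports.

Local Open Scope classical_set_scope.
Local Open Scope ring_scope.

(** A harmonic eigenvector y for the eigenvalue lambda satisfies
    A y = (1 - lambda) D y, and the given ones are pairwise orthogonal for the
    inner product x^T D y.  Everything is done with this inner product and the form
    x^T A y, without square roots of degrees.

    Lower bound.  For a set S, take f = s + a 1, where s is the +-1 vector of S
    and a makes f D-orthogonal to 1.  Since D - A kills 1, its value at f is
    its value at s, namely 4 cut(S), while f^T D f = 4 vol(S) (1 - vol(S)/vol G)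
    is at least 2 vol(S) when vol(S) <= vol(G)/2.  The Rayleigh quotient of f is
    at least lambda_1 because the eigenvectors span ([eigen_span]), so
    cut(S) / vol(S) >= lambda_1 / 2 ([cheeger_lower]).

    Upper bound.  Let x = v / |v|_oo, a point of the cube [-1, 1]^n with
    sum_i d_i x_i = 0, and let b be the bracket in the upper bound.  As v
    combines y_1, ..., y_k, v^T A v >= 1 - lambda_k, that is
    vol(G) - x^T A x <= 2 b vol(G) ([scaled_discrepancy]).  For a +-1 vector s
    of a set S, vol(G) - s^T A s = 4 cut(S) and
    sum_i d_i s_i = 2 vol(S) - vol(G).  The usual argument picks i in S
    independently with probability (1 + x_i) / 2: this cuts at most
    b vol(G) / 2 edges on average, and vol(S) is concentrated around
    vol(G) / 2.  Both are controlled at once by one quadratic form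
      M ((sum_i d_i x_i)^2 - sum_i d_i^2 x_i^2) - K x^T A x.
    It has zero diagonal, so it is affine in each coordinate and rounding the
    coordinates to +-1 one at a time never increases it ([round_to_signs]).
    The sign vector reached cuts at most (1 + e) b vol(G) / 2 edges and has
    volume within e vol(G) of vol(G) / 2 as soon as Delta / vol(G) <= e^4, whence
    h <= b (1 + e) / (1 - 2 e) ([cheeger_upper]).  Under the hypothesis
    e = (Delta / vol G)^(1/4) tends to 0.

    The error term has to be a finite number for each n and cannot depend on k
    and v, also when e is too large for this to say anything.  There
    S = {i | 0 < x_i} gives h <= b vol(G) ([cheeger_le_discrepancy]): an edge
    that it cuts has x_i x_j <= 0, hence is cut with probability at least 1/2 in
    the random choice.  This also settles the case b = 0. *)

(** * Bilinear forms and rounding to sign vectors *)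

Section QuadraticForms.
Variables (R : realFieldType) (n : nat).
Implicit Types (B : 'M[R]_n) (x y : 'cV[R]_n) (S : {set 'I_n}).

Definition bform B x y : R := (x^T *m B *m y) ord0 ord0.

Lemma bformE B x y :
  bform B x y = \sum_i \sum_j B i j * x i ord0 * y j ord0.
Proof.
rewrite /bform -mulmxA mxE; apply: eq_bigr => i _.
rewrite !mxE mulr_sumr; apply: eq_bigr => j _; ring.
Qed.

Lemma bformDl B x1 x2 y : bform B (x1 + x2) y = bform B x1 y + bform B x2 y.
Proof. by rewrite /bform linearD /= !mulmxDl mxE. Qed.

Lemma bformDr B x y1 y2 : bform B x (y1 + y2) = bform B x y1 + bform B x y2.
Proof. by rewrite /bform mulmxDr mxE. Qed.

Lemma bformZl B a x y : bform B (a *: x) y = a * bform B x y.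
Proof. by rewrite /bform linearZ /= -!scalemxAl mxE. Qed.

Lemma bformZr B a x y : bform B x (a *: y) = a * bform B x y.
Proof. by rewrite /bform -!scalemxAr mxE. Qed.

Lemma bform_mxD B1 B2 x y : bform (B1 + B2) x y = bform B1 x y + bform B2 x y.
Proof. by rewrite /bform mulmxDr mulmxDl mxE. Qed.

Lemma bform_mxZ a B x y : bform (a *: B) x y = a * bform B x y.
Proof. by rewrite /bform -scalemxAr -scalemxAl mxE. Qed.

Lemma bform_sym B x y : B^T = B -> bform B x y = bform B y x.
Proof.
move=> BT; rewrite !bformE exchange_big /=.
apply: eq_bigr => i _; apply: eq_bigr => j _.
by rewrite -[in LHS]BT mxE mulrAC.
Qed.

Definition sign_vector S : 'cV[R]_n := \col_i (if i \in S then 1 else -1).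

(** A zero diagonal entry makes the form affine in the coordinate i, hence
    minimal at an endpoint of [-1, 1]; which one depends on the slope. *)
Lemma round_coordinate B x i : B i i = 0 -> `|x i ord0| <= 1 ->
  exists2 a, `|x i ord0 + a| = 1 &
    bform B (x + a *: delta_mx i ord0) (x + a *: delta_mx i ord0) <= bform B x x.
Proof.
move=> Bii; rewrite ler_norml => /andP[xm1 x1]; set e := delta_mx i ord0.
have Bee : bform B e e = 0.
  rewrite bformE (bigD1 i) //= [X in _ + X]big1 => [|j ji].
    rewrite (bigD1 i) //= Bii big1 => [|j ji]; first by rewrite !mul0r !addr0.
    by rewrite [X in _ * X]mxE (negPf ji) mulr0.
  by apply: big1 => k _; rewrite mxE (negPf ji) mulr0 mul0r.
have expand a : bform B (x + a *: e) (x + a *: e) =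
    bform B x x + a * (bform B x e + bform B e x).
  by rewrite !(bformDl, bformDr, bformZl, bformZr) Bee; ring.
have [l0|l0] := leP 0 (bform B x e + bform B e x).
  exists (- 1 - x i ord0); first by rewrite subrKC normrN normr1.
  by rewrite expand gerDl mulr_le0_ge0 //; lra.
exists (1 - x i ord0); first by rewrite subrKC normr1.
by rewrite expand gerDl mulr_ge0_le0 //; lra.
Qed.

(** A derandomization: the form is multi-affine, so its value at x is the mean
    of its values at independent random signs with means x_i. *)
Lemma round_to_signs B x :
  (forall i, B i i = 0) -> (forall i, `|x i ord0| <= 1) ->
  exists S, bform B (sign_vector S) (sign_vector S) <= bform B x x.
Proof.
move=> B0 x1.
have rounded : forall m, (m <= n)%N -> exists z : 'cV[R]_n,
    [/\ forall i, `|z i ord0| <= 1, forall i : 'I_n, (i < m)%N -> `|z i ord0| = 1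
      & bform B z z <= bform B x x].
  elim=> [_|m IHm mn]; first by exists x; split.
  have [z [z_le1 z1 zx]] := IHm (ltnW mn).
  have [a a1 az] := round_coordinate (B0 (Ordinal mn)) (z_le1 (Ordinal mn)).
  pose z' := z + a *: delta_mx (Ordinal mn) ord0.
  have z'1 : `|z' (Ordinal mn) ord0| = 1 by rewrite !mxE !eqxx mulr1.
  have z'E i : i != Ordinal mn -> z' i ord0 = z i ord0.
    by move=> im; rewrite !mxE (negPf im) mulr0 addr0.
  exists z'; split=> [i|i|].
  - by have [->|/z'E->] := eqVneq i (Ordinal mn); rewrite ?z'1.
  - have [->//|im] := eqVneq i (Ordinal mn).
    by rewrite ltnS leq_eqVlt (negPf (im : i != m :> nat)) /= z'E // => /z1.
  - exact: le_trans zx.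
have [z [_ z1 zx]] := rounded n (leqnn n).
exists [set i | z i ord0 == 1]%SET.
suff -> : sign_vector [set i | z i ord0 == 1]%SET = z by [].
apply/colP => i; rewrite mxE inE; case: eqP => [-> //|z_neq1].
by have /eqP := z1 i (ltn_ord i); rewrite eqr_norml => /andP[/orP[]/eqP].
Qed.

End QuadraticForms.

(** * Volumes and cuts as values of forms *)

Section DegreeAndAdjacencyForms.
Variables (R : realType) (n : nat) (g : simple_graph n).
Implicit Types (x y : 'cV[R]_n) (S : {set 'I_n}).

Definition deg_mx : 'M[R]_n := diag_mx (\row_i (degree g i)%:R).

Notation A := (adj_mx R g).
Notation V := ((volG g)%:R : R).
Notation ones := (const_mx 1 : 'cV[R]_n).

Lemma adj_mx_sym : A^T = A.
Proof. by apply/matrixP => i j; rewrite !mxE adjacent_sym. Qed.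

Lemma bform_deg x y :
  bform deg_mx x y = \sum_i (degree g i)%:R * x i ord0 * y i ord0.
Proof.
rewrite bformE; apply: eq_bigr => i _; rewrite (bigD1 i) //= big1 => [|j ji].
  by rewrite !mxE eqxx mulr1n addr0.
by rewrite !mxE eq_sym (negPf ji) mulr0n !mul0r.
Qed.

Lemma bform_deg_ones x :
  bform deg_mx x ones = \sum_i (degree g i)%:R * x i ord0.
Proof. by rewrite bform_deg; apply: eq_bigr => i _; rewrite [ones _ _]mxE mulr1. Qed.

Lemma deg_mx_sym : deg_mx^T = deg_mx.
Proof. exact: tr_diag_mx. Qed.

(** The rows of A sum to the degrees: 1 is in the kernel of D - A. *)
Lemma bform_adj_ones x : bform A x ones = bform deg_mx x ones.
Proof.
rewrite bform_deg_ones bformE; apply: eq_bigr => i _.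
under eq_bigr => j _ do rewrite [ones _ _]mxE mulr1 mxE.
rewrite -mulr_suml -natr_sum; congr (_%:R * _).
rewrite /degree -sum1_card [RHS]big_mkcond; apply: eq_bigr => j _.
by rewrite inE; case: (g i j).
Qed.

Lemma volGE : V = \sum_i (degree g i)%:R.
Proof.
by rewrite /volG /vol natr_sum; apply: eq_bigl => i; rewrite finset.in_setT.
Qed.

Lemma vol_setC S : (vol g S + vol g (~: S) = volG g)%N.
Proof.
rewrite /volG /vol [RHS](bigID (mem S)) /=; congr addn;
by apply: eq_bigl => i; rewrite ?inE.
Qed.

Lemma bform_deg_ones_ones : bform deg_mx ones ones = V.
Proof. by rewrite bform_deg_ones volGE; apply: eq_bigr => i _; rewrite mxE mulr1. Qed.

Lemma sign_vectorC S : sign_vector R (~: S) = - sign_vector R S.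
Proof. by apply/colP => i; rewrite !mxE inE; case: (i \in S); rewrite ?opprK. Qed.

Lemma bform_deg_sign S :
  bform deg_mx (sign_vector R S) (sign_vector R S) = V.
Proof.
rewrite bform_deg volGE; apply: eq_bigr => i _.
by rewrite mxE; case: ifP => _; ring.
Qed.

Lemma bform_deg_sign_ones S :
  bform deg_mx (sign_vector R S) ones = 2 * (vol g S)%:R - V.
Proof.
rewrite bform_deg_ones -(vol_setC S) natrD /vol !natr_sum.
rewrite (bigID (mem S)) /=.
rewrite (eq_bigr (fun i => (degree g i)%:R)) => [|i iS]; last first.
  by rewrite mxE iS mulr1.
rewrite [X in _ + X](eq_bigr (fun i => - (degree g i)%:R)) => [|i iS]; last first.
  by rewrite mxE (negPf iS) mulrN1.
rewrite sumrN [X in _ - (_ + X)](eq_bigl (fun i => i \notin S)); last first.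
  by move=> i; rewrite inE.
ring.
Qed.

Lemma volG_bform_adj : V = bform A ones ones.
Proof. by rewrite bform_adj_ones bform_deg_ones_ones. Qed.

Lemma volG_sub_bform_adj x :
  V - bform A x x = \sum_i \sum_j A i j * (1 - x i ord0 * x j ord0).
Proof.
rewrite volG_bform_adj !bformE -sumrB; apply: eq_bigr => i _.
by rewrite -sumrB; apply: eq_bigr => j _; rewrite ![ones _ _]mxE; ring.
Qed.

Lemma cutE S :
  (Defs.cut g S)%:R = \sum_i \sum_j A i j * ((i \in S) && (j \notin S))%:R :> R.
Proof.
rewrite /Defs.cut -sum1_card big_mkcond natr_sum pair_big /=.
apply: eq_bigr => -[i j] _ /=; rewrite inE mxE /=.
by case: (i \in S) => /=; rewrite ?mulr0 //; case: (j \in S) => /=;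
   case: (g i j); rewrite /= ?mulr0 ?mulr1.
Qed.

(** Each cut edge is met in both orientations, with 1 - s_i s_j = 2. *)
Lemma bform_adj_sign S :
  V - bform A (sign_vector R S) (sign_vector R S) = 4 * (Defs.cut g S)%:R.
Proof.
rewrite volG_sub_bform_adj.
have -> : 4 * (Defs.cut g S)%:R =
    2 * (Defs.cut g S)%:R + 2 * (Defs.cut g S)%:R :> R by ring.
rewrite {2}cutE [X in _ + 2 * X]exchange_big cutE /= !mulr_sumr -big_split /=.
apply: eq_bigr => i _; rewrite !mulr_sumr -big_split /=; apply: eq_bigr => j _.
rewrite !mxE [g j i]adjacent_sym.
by case: (i \in S); case: (j \in S); rewrite /=; ring.
Qed.

Lemma cut_setC S : Defs.cut g (~: S) = Defs.cut g S.
Proof.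
apply/eqP; rewrite -(eqr_nat R); apply/eqP/(@mulfI _ 4) => //.
by rewrite -!bform_adj_sign sign_vectorC -[- sign_vector R S]scaleN1r bformZl bformZr; ring.
Qed.

(** Whichever of S and its complement has the smaller volume is admissible for
    the Cheeger constant, and both have the same cut. *)
Lemma cheeger_mul_le_cut S (t : R) : no_isolated g -> 0 < t ->
  t <= (vol g S)%:R -> t <= V - (vol g S)%:R ->
  cheeger R g * t <= (Defs.cut g S)%:R.
Proof.
move=> g0 t0 tS tSC.
have n0 : (0 < n)%N.
  rewrite lt0n; apply/eqP => n0; have := lt_le_trans t0 tS.
  by rewrite /vol big_pred0 ?ltxx // => i; have := ltn_ord i; rewrite [X in (_ < X)%N]n0.
have [_ hmin] := cheeger_min R n0 g0.
wlog half : S tS tSC / (2 * vol g S <= volG g)%N => [hwlog|].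
  have [|gt] := leqP (2 * vol g S) (volG g); first exact: hwlog.
  have VE : V = (vol g S)%:R + (vol g (~: S))%:R by rewrite -natrD vol_setC.
  rewrite -cut_setC; apply: hwlog; [lra | lra|].
  by move: gt; rewrite -(vol_setC S); lia.
have S0 : (0 < vol g S)%N by rewrite -(ltr_nat R); exact: lt_le_trans tS.
have /= hS := hmin S; rewrite S0 half in hS.
have ch0 : 0 <= (Defs.cut g S)%:R / (vol g S)%:R :> R by rewrite divr_ge0.
apply: le_trans (_ : (Defs.cut g S)%:R / (vol g S)%:R * t <= _).
  by rewrite ler_pM2r // hS.
rewrite mulrAC ler_pdivrMr ?ltr0n // ler_wpM2l //.
Qed.

End DegreeAndAdjacencyForms.

(** * From a point of the cube to a set with a small cut *)

Section SignVectorsFromPointsOfTheCube.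
Variables (R : realType) (n : nat) (g : simple_graph n) (x : 'cV[R]_n).
Hypotheses (g0 : no_isolated g) (x_le1 : forall i, `|x i ord0| <= 1).

Notation A := (adj_mx R g).
Notation D := (deg_mx R g).
Notation V := ((volG g)%:R : R).
Notation ones := (const_mx 1 : 'cV[R]_n).

Hypothesis x_ones : bform D x ones = 0.

(** The square of the linear form sum_i d_i x_i with its diagonal removed, so
    that coordinates can be rounded.  At a sign vector this only shifts the
    square by the constant sum_i d_i^2. *)
Definition imbalance_mx : 'M[R]_n :=
  \matrix_(i, j) ((degree g i)%:R * (degree g j)%:R * (i != j)%:R).

Lemma bform_imbalance y :
  bform imbalance_mx y y =
  bform D y ones ^+ 2 - \sum_i (degree g i)%:R ^+ 2 * y i ord0 ^+ 2.
Proof.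
rewrite bformE bform_deg_ones expr2 big_distrlr -sumrB; apply: eq_bigr => i _ /=.
rewrite (bigD1 i) //= [in RHS](bigD1 i) //= [imbalance_mx i i]mxE eqxx.
under eq_bigr => j ji do rewrite mxE eq_sym ji mulr1.
rewrite mulr0 !mul0r add0r addrAC -[LHS]add0r; congr (_ + _); first by ring.
by apply: eq_bigr => j _; ring.
Qed.

Lemma sum_sqr_degree_le :
  \sum_i (degree g i)%:R ^+ 2 <= (max_degree g)%:R * V.
Proof.
rewrite volGE mulr_sumr; apply: ler_sum => i _.
by rewrite expr2 ler_wpM2r // ler_nat /max_degree leq_bigmax.
Qed.

Lemma exists_pos_coord (y : 'cV[R]_n) :
  bform D y ones = 0 -> y != 0 -> exists i, 0 < y i ord0.
Proof.
move=> y1 y0; apply/existsP; apply: contraNT y0 => /existsPn y_le0.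
have {}y_le0 i : y i ord0 <= 0 by rewrite leNgt.
have /eqP := y1; rewrite bform_deg_ones -oppr_eq0 -sumrN psumr_eq0 => [|i _].
  move=> /allP y0; apply/eqP/colP => i; have := y0 i (mem_index_enum _).
  by rewrite /= oppr_eq0 mulf_eq0 pnatr_eq0 gtn_eqF //= mxE => /eqP.
by rewrite -mulrN mulr_ge0 // oppr_ge0.
Qed.

Lemma vol_gt0 (S : {set 'I_n}) i : i \in S -> (0 < vol g S)%N.
Proof. by move=> iS; rewrite /vol (bigD1 i) //= addn_gt0 g0. Qed.

(** The crude bound.  Rounding every coordinate to its sign at most doubles
    1 - x_i x_j, and since sum_i d_i x_i = 0 both sides are nonempty, hence of
    volume at least 1. *)
Lemma cheeger_le_discrepancy :
  x != 0 -> cheeger R g <= (V - bform A x x) / 2.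
Proof.
move=> x0; pose S := [set i | 0 < x i ord0]%SET.
have [i xi] := exists_pos_coord x_ones x0.
have [||j xj] := @exists_pos_coord (- x); first 2 last.
- have S0 : (0 < vol g S)%N by apply: (@vol_gt0 _ i); rewrite inE.
  have SC0 : (0 < vol g (~: S))%N.
    by apply: (@vol_gt0 _ j); rewrite !inE -leNgt; move: xj; rewrite mxE; lra.
  have volSC : 1 <= V - (vol g S)%:R by rewrite -(vol_setC g S) natrD addrC addKr ler1n.
  have volS : 1 <= (vol g S)%:R :> R by rewrite ler1n.
  have := cheeger_mul_le_cut g0 ltr01 volS volSC.
  have cutW : 4 * (Defs.cut g S)%:R <= 2 * (V - bform A x x).
    rewrite -bform_adj_sign !volG_sub_bform_adj mulr_sumr.
    apply: ler_sum => k _; rewrite mulr_sumr; apply: ler_sum => l _.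
    rewrite mulrCA; apply: ler_wpM2l; first by rewrite mxE.
    have := x_le1 k; have := x_le1 l; rewrite !ler_norml !mxE !inE.
    by case: (ltP _ (x k _)) => ?; case: (ltP _ (x l _)) => ? /andP[? ?] /andP[? ?]; nra.
  by lra.
- by rewrite -scaleN1r bformZl x_ones mulr0.
- by rewrite oppr_eq0.
Qed.

(** The sharp bound, by rounding a weighted sum of the imbalance and of the cut.
    At the sign vector reached, both are nonnegative and their weighted sum is
    at most M (1 + e) K, so each of them obeys that bound alone. *)
Lemma cheeger_le_balanced (M e : R) :
  0 < e < 1 / 2 -> (max_degree g)%:R <= e ^+ 4 * V ->
  0 < V -> 0 < M -> V - bform A x x <= M ->
  cheeger R g * (V * (1 - 2 * e)) <= (1 + e) * M / 2.
Proof.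
move=> /andP[e0 e1] degV V0 M0 WM.
(* With the weights K and M, the term V - x^T A x <= M of the cut contributes at
   most K M, and the term sum_i d_i^2 <= e^4 V^2 = e K of the imbalance at most
   the fraction e of that. *)
pose K := e ^+ 3 * V ^+ 2.
have K0 : 0 < K by rewrite mulr_gt0 // exprn_gt0.
have [i|S] := round_to_signs (B := M *: imbalance_mx + (- K) *: A) (x := x) _ x_le1.
  by rewrite !mxE adjacent_irr eqxx !mulr0 addr0.
rewrite !bform_mxD !bform_mxZ !bform_imbalance x_ones bform_deg_sign_ones.
have := bform_adj_sign R g S; set Q := bform A _ _ => QE.
set s2 := \sum_i _; have -> : s2 = \sum_i (degree g i)%:R ^+ 2.
  by apply: eq_bigr => i _; rewrite mxE; case: ifP => _; ring.
set d2 := \sum_i _; set x2 := \sum_i _ => rounded.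
have x2_ge0 : 0 <= x2 by apply: sumr_ge0 => i _; rewrite mulr_ge0 ?sqr_ge0.
have d2_le : d2 <= e * K.
  apply: le_trans sum_sqr_degree_le _.
  have -> : e * K = e ^+ 4 * V * V by rewrite /K; ring.
  by rewrite ler_wpM2r // ltW.
have : M * (2 * (vol g S)%:R - V) ^+ 2 + 4 * (Defs.cut g S)%:R * K
     <= M * ((1 + e) * K).
  have MV : M * (d2 - x2) <= M * (e * K) by rewrite ler_wpM2l ?(ltW M0); lra.
  have KW : K * (V - bform A x x) <= K * M by rewrite ler_wpM2l ?(ltW K0).
  by move: rounded MV KW; rewrite -QE; nra.
move=> both.
have cutM : 4 * (Defs.cut g S)%:R <= M * (1 + e).
  rewrite -(ler_pM2r K0) -[leRHS]mulrA; apply: le_trans both.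
  by rewrite lerDr mulr_ge0 ?sqr_ge0 ?ltW.
have volM : (2 * (vol g S)%:R - V) ^+ 2 <= (2 * e * V) ^+ 2.
  have : (2 * (vol g S)%:R - V) ^+ 2 <= (1 + e) * K.
    rewrite -(ler_pM2l M0); apply: le_trans both.
    by rewrite lerDl; apply: mulr_ge0; [exact: mulr_ge0 | exact: ltW].
  move/le_trans; apply.
  have -> : (2 * e * V) ^+ 2 = 4 * (e ^+ 2 * V ^+ 2) by ring.
  have -> : (1 + e) * K = (e + e ^+ 2) * (e ^+ 2 * V ^+ 2) by rewrite /K; ring.
  by rewrite ler_wpM2r ?mulr_ge0 ?sqr_ge0 //; nra.
have /andP[volSC volS] : - (2 * e * V) <= 2 * (vol g S)%:R - V <= 2 * e * V.
  rewrite -ler_norml -(@ler_pXn2r _ 2) ?nnegrE ?normr_ge0 ?real_normK ?num_real //.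
  by rewrite !mulr_ge0 ?ltW.
have := @cheeger_mul_le_cut R n g S (V * (1 - 2 * e) / 2) g0.
have -> : (0 < V * (1 - 2 * e) / 2) = true by rewrite divr_gt0 // mulr_gt0 //; lra.
move=> /(_ isT) => /(_ ltac:(lra) ltac:(lra)); lra.
Qed.

End SignVectorsFromPointsOfTheCube.

(** * Rayleigh quotients of harmonic eigenvectors *)

Section HarmonicEigenvectors.
Variables (R : realType) (n : nat) (g : simple_graph n).
Hypothesis g0 : no_isolated g.

Notation A := (adj_mx R g).
Notation D := (deg_mx R g).
Notation V := ((volG g)%:R : R).
Notation ones := (const_mx 1 : 'cV[R]_n).

Lemma sqrt_deg_mx_sqr : sqrt_deg_mx R g *m sqrt_deg_mx R g = D.
Proof.
rewrite /sqrt_deg_mx mulmx_diag; congr diag_mx; apply/rowP => i.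
by rewrite !mxE -expr2 sqr_sqrtr.
Qed.

Lemma sqrt_deg_mx_sym : (sqrt_deg_mx R g)^T = sqrt_deg_mx R g.
Proof. exact: tr_diag_mx. Qed.

Lemma sqrt_deg_mxV : sqrt_deg_mx R g *m inv_sqrt_deg_mx R g = 1%:M.
Proof.
rewrite /sqrt_deg_mx /inv_sqrt_deg_mx mulmx_diag -diag_const_mx; congr diag_mx.
by apply/rowP => i; rewrite !mxE mulfV // gt_eqF // sqrtr_gt0 ltr0n.
Qed.

Lemma sqrt_deg_bform x z :
  (sqrt_deg_mx R g *m x)^T *m (sqrt_deg_mx R g *m z) = (bform D x z)%:M.
Proof.
rewrite [LHS]mx11_scalar /bform -sqrt_deg_mx_sqr trmx_mul sqrt_deg_mx_sym.
by rewrite !mulmxA.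
Qed.

Lemma sqrt_laplacian_sqrt :
  sqrt_deg_mx R g *m normalized_laplacian R g *m sqrt_deg_mx R g = D - A.
Proof.
rewrite /normalized_laplacian mulmxBr mulmxBl mulmx1 sqrt_deg_mx_sqr.
congr (_ - _); rewrite !mulmxA sqrt_deg_mxV mul1mx -mulmxA.
suff -> : inv_sqrt_deg_mx R g *m sqrt_deg_mx R g = 1%:M by rewrite mulmx1.
by rewrite -sqrt_deg_mxV /sqrt_deg_mx /inv_sqrt_deg_mx diag_mxC.
Qed.

Lemma bform_harmonic a x z : harmonic_eigenvector g a z ->
  bform A x z = (1 - a) * bform D x z.
Proof.
move=> [_ eig]; have DAz : (D - A) *m z = a *: (D *m z).
  by rewrite -sqrt_laplacian_sqrt -!mulmxA eig -scalemxAr mulmxA sqrt_deg_mx_sqr.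
have : bform (D - A) x z = a * bform D x z.
  by rewrite /bform -mulmxA DAz -scalemxAr mulmxA mxE.
by rewrite -[- A]scaleN1r bform_mxD bform_mxZ; lra.
Qed.

Lemma harmonic_bform_gt0 a z : harmonic_eigenvector g a z -> 0 < bform D z z.
Proof.
move=> [z0 _]; rewrite lt_neqAle andbC bform_deg; apply/andP; split.
  by apply: sumr_ge0 => i _; rewrite -mulrA mulr_ge0 // -expr2 sqr_ge0.
apply: contraNneq z0 => /esym /eqP.
rewrite psumr_eq0 => [/allP zi|i _]; last first.
  by rewrite -mulrA mulr_ge0 // -expr2 sqr_ge0.
apply/eqP; suff -> : z = 0 by rewrite mulmx0.
apply/colP => i; have := zi i (mem_index_enum _).
by rewrite /= -mulrA -expr2 mulf_eq0 pnatr_eq0 gtn_eqF //= sqrf_eq0 mxE => /eqP.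
Qed.

Variables (lam : n.-tuple R) (y : 'I_n -> 'cV[R]_n).
Hypothesis eigen : harmonic_eigensystem g lam y.

Let N i : R := bform D (y i) (y i).

Lemma eigen_N_gt0 i : 0 < N i.
Proof. by have [_ _ /(_ i) /harmonic_bform_gt0] := eigen. Qed.

Lemma eigen_ortho i j : i != j -> bform D (y i) (y j) = 0.
Proof.
have [_ _ _ ort _] := eigen => ij; have := ort i j ij; rewrite sqrt_deg_bform.
by move=> /matrixP /(_ ord0 ord0); rewrite !mxE eqxx mulr1n.
Qed.

Lemma eigen_coef (c : 'I_n -> R) j :
  bform D (\sum_i c i *: y i) (y j) = c j * N j.
Proof.
rewrite /bform linear_sum /= !mulmx_suml summxE (bigD1 j) //= big1 => [|i ij].
  by rewrite -/(bform _ _ _) bformZl addr0.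
by rewrite -/(bform _ _ _) bformZl eigen_ortho ?mulr0.
Qed.

Lemma eigen_bform_deg (c : 'I_n -> R) (v := \sum_i c i *: y i) :
  bform D v v = \sum_i c i ^+ 2 * N i.
Proof.
rewrite {2}/v /bform mulmx_sumr summxE; apply: eq_bigr => i _.
by rewrite -/(bform _ _ _) bformZr eigen_coef; ring.
Qed.

Lemma eigen_bform_adj (c : 'I_n -> R) (v := \sum_i c i *: y i) :
  bform A v v = \sum_(i < n) (1 - lam`_i) * (c i ^+ 2 * N i).
Proof.
rewrite {2}/v /bform mulmx_sumr summxE; apply: eq_bigr => i _.
have [_ _ /(_ i) eig _ _] := eigen; rewrite (tnth_nth 0) in eig.
by rewrite -/(bform _ _ _) bformZr (bform_harmonic _ eig) eigen_coef; ring.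
Qed.

(** The eigenvectors are nonzero and D-orthogonal: with Y the matrix of their
    columns, Y^T D Y is diagonal and invertible, so Y is invertible. *)
Lemma eigen_span x : exists c : 'I_n -> R, x = \sum_i c i *: y i.
Proof.
pose Y : 'M[R]_n := \matrix_(i, j) y j i ord0.
have colY j : col j Y = y j by apply/colP => i; rewrite !mxE.
have YDY : Y^T *m D *m Y = diag_mx (\row_i N i).
  apply/matrixP => i j.
  have -> : (Y^T *m D *m Y) i j = bform D (y i) (y j).
    rewrite -!colY /bform tr_col -row_mul [LHS]mxE [RHS]mxE; apply: eq_bigr => k _.
    by rewrite [row _ _ _ _]mxE [col _ _ _ _]mxE.
  rewrite !mxE; have [->//|ij] := eqVneq i j; exact: eigen_ortho.
have : Y \in unitmx.
  have : Y^T *m D *m Y \in unitmx.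
    rewrite YDY unitmxE det_diag unitfE; apply/prodf_neq0 => i _.
    by rewrite mxE gt_eqF ?eigen_N_gt0.
  by rewrite unitmx_mul => /andP[].
move=> Yu; exists (fun i => (invmx Y *m x) i ord0).
rewrite -[LHS](mulKVmx Yu); apply/colP => i; rewrite mxE summxE.
by apply: eq_bigr => j _; rewrite !mxE mulrC.
Qed.

Lemma eigen_sorted (i j : nat) : (i <= j < n)%N -> lam`_i <= lam`_j.
Proof.
move=> /andP[ij jn]; have [lam_sorted _ _ _ _] := eigen.
by apply: (sorted_leq_nth le_trans le_refl 0 lam_sorted); rewrite ?inE ?size_tuple //; lia.
Qed.

(** The eigenvector of index 0 is a nonzero multiple of 1. *)
Lemma eigen_ones (i : 'I_n) x : i = 0%N :> nat ->
  (bform D x (y i) == 0) = (bform D x ones == 0).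
Proof.
move=> i0; have [_ _ /(_ i)/harmonic_bform_gt0 + _ /(_ i i0)[c yE]] := eigen.
rewrite yE !(bformZr, bformZl) => /lt0r_neq0; rewrite mulf_eq0 negb_or => /andP[c0 _].
by rewrite mulf_eq0 (negPf c0).
Qed.

Lemma rayleigh_le k v : (0 < k < n)%N ->
  (exists c : 'I_n -> R, v = \sum_(i < n | (0 < i <= k)%N) c i *: y i) ->
  bform D v ones = 0 /\ (1 - lam`_k) * bform D v v <= bform A v v.
Proof.
move=> /andP[k0 kn] [c ->]; pose c' (i : 'I_n) := if (0 < i <= k)%N then c i else 0.
have -> : \sum_(i < n | (0 < i <= k)%N) c i *: y i = \sum_i c' i *: y i.
  rewrite big_mkcond; apply: eq_bigr => i _; rewrite /c'; case: ifP => //.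
  by rewrite scale0r.
split.
  apply/eqP; rewrite -(@eigen_ones (Ordinal (leq_trans k0 (ltnW kn)))) //.
  by rewrite eigen_coef /c' mul0r.
rewrite eigen_bform_deg eigen_bform_adj mulr_sumr; apply: ler_sum => i _.
rewrite /c'; case: ifP => [/andP[_ ik]|_]; last by rewrite expr0n /= mul0r !mulr0.
apply: ler_wpM2r; first by rewrite mulr_ge0 ?sqr_ge0 // ltW // eigen_N_gt0.
apply: lerB => //; apply: eigen_sorted.
by rewrite ik.
Qed.

Lemma rayleigh_ge x : bform D x ones = 0 ->
  bform A x x <= (1 - lam`_1) * bform D x x.
Proof.
have [c ->] := eigen_span x => /eqP x1.
rewrite eigen_bform_deg eigen_bform_adj mulr_sumr; apply: ler_sum => i _.
have [i0|i0] := posnP i.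
  move: x1; rewrite -(eigen_ones _ i0) eigen_coef mulf_eq0 (gt_eqF (eigen_N_gt0 i)) orbF.
  by move=> /eqP ->; rewrite expr0n /= mul0r !mulr0.
apply: ler_wpM2r; first by rewrite mulr_ge0 ?sqr_ge0 // ltW // eigen_N_gt0.
apply: lerB => //; apply: eigen_sorted.
by rewrite i0 ltn_ord.
Qed.

Lemma cheeger_lower : (1 < n)%N -> lam`_1 / 2 <= cheeger R g.
Proof.
move=> n1; have [[S /andP[S0 S2] ->] _] := cheeger_min R (ltnW n1) g0.
have lam1 : 0 <= lam`_1.
  by have [_ lam0 _ _ _] := eigen; rewrite -[leLHS]lam0 eigen_sorted.
have {}S0 : 0 < (vol g S)%:R :> R by rewrite ltr0n.
have {}S2 : 2 * (vol g S)%:R <= V by rewrite -natrM ler_nat.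
have V0 : 0 < V by lra.
rewrite ler_pdivlMr //.
set s := sign_vector R S.
(* This a makes f D-orthogonal to 1, as s^T D 1 = 2 vol(S) - vol(G). *)
pose a := (1 - 2 * (vol g S)%:R / V).
pose f := s + a *: ones.
have sym1 : bform D ones s = bform D s ones by rewrite bform_sym // deg_mx_sym.
have symA : bform A ones s = bform A s ones by rewrite bform_sym // adj_mx_sym.
have f1 : bform D f ones = 0.
  rewrite bformDl bformZl bform_deg_sign_ones bform_deg_ones_ones /a.
  by field; rewrite gt_eqF.
have := rayleigh_ge f1.
have -> : bform A f f = bform A s s - V + bform D f f.
  rewrite !(bformDl, bformDr, bformZl, bformZr) symA sym1 !bform_adj_ones.
  rewrite bform_deg_sign; ring.
have -> : bform A s s - V = - (4 * (Defs.cut g S)%:R).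
  by rewrite -bform_adj_sign opprB.
have -> : bform D f f = 4 * (vol g S)%:R * (1 - (vol g S)%:R / V).
  rewrite !(bformDl, bformDr, bformZl, bformZr) sym1 bform_deg_sign_ones.
  rewrite bform_deg_sign bform_deg_ones_ones /a; field; by rewrite gt_eqF.
have half : (vol g S)%:R / V <= 1 / 2 by rewrite ler_pdivrMr //; lra.
have : 0 <= lam`_1 * (vol g S)%:R * (1 / 2 - (vol g S)%:R / V).
  by rewrite mulr_ge0 ?mulr_ge0 ?subr_ge0 // ltW.
nra.
Qed.

End HarmonicEigenvectors.

(** * The upper bound for one graph *)

Section UpperBound.
Variables (R : realType) (n : nat) (g : simple_graph n) (l : R) (v : 'cV[R]_n).
Hypotheses (g0 : no_isolated g) (n0 : (0 < n)%N).

Notation A := (adj_mx R g).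
Notation D := (deg_mx R g).
Notation V := ((volG g)%:R : R).
Notation ones := (const_mx 1 : 'cV[R]_n).

Hypotheses (v_ones : bform D v ones = 0) (v_norm : bform D v v = 1).
Hypothesis v_rayleigh : 1 - l <= bform A v v.

Let m : R := norm_oo v.
Let b : R := 1 / 2 - (1 - l) / (2 * m ^+ 2 * V).
Let x : 'cV[R]_n := m^-1 *: v.

Lemma volG_gt0 : 0 < V.
Proof.
by rewrite ltr0n /volG (@vol_gt0 _ _ g0 _ (Ordinal n0)) ?finset.in_setT.
Qed.

Lemma cheeger_ge0 : 0 <= cheeger R g.
Proof. by have [[S _ ->] _] := cheeger_min R n0 g0; rewrite divr_ge0. Qed.

Lemma le_norm_oo i : `|v i ord0| <= m.
Proof. exact: (le_bigmax 0 (fun i => `|v i ord0|)). Qed.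

Lemma norm_oo_gt0 : 0 < m.
Proof.
rewrite lt_neqAle andbC bigmax_ge_id; apply/eqP => m0.
have v0 : v = 0.
  apply/colP => i; rewrite mxE; apply/normr0_eq0/le_anti.
  by rewrite normr_ge0 m0 le_norm_oo.
by move: v_norm; rewrite v0 -(scale0r 0) bformZl mul0r => /eqP; rewrite eq_sym oner_eq0.
Qed.

Lemma scaled_le1 i : `|x i ord0| <= 1.
Proof.
rewrite mxE normrM normfV (gtr0_norm norm_oo_gt0) mulrC.
by rewrite ler_pdivrMr ?norm_oo_gt0 // mul1r le_norm_oo.
Qed.

Lemma scaled_ones : bform D x ones = 0.
Proof. by rewrite bformZl v_ones mulr0. Qed.

Lemma scaled_neq0 : x != 0.
Proof.
apply/eqP => x0; have := v_norm; have -> : v = m *: x.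
  by rewrite scalerA mulfV ?scale1r // gt_eqF ?norm_oo_gt0.
by rewrite x0 scaler0 -(scale0r 0) bformZl mul0r => /eqP; rewrite eq_sym oner_eq0.
Qed.

Lemma scaled_discrepancy : V - bform A x x <= 2 * V * b.
Proof.
have m0 := norm_oo_gt0; have V0 := volG_gt0.
have -> : 2 * V * b = V - (1 - l) / m ^+ 2.
  by rewrite /b; field; rewrite !gt_eqF.
rewrite lerB // bformZl bformZr mulrA -invfM -expr2 mulrC.
by rewrite ler_wpM2l // invr_ge0 sqr_ge0.
Qed.

Lemma cheeger_le_vol_bound : cheeger R g <= V * b.
Proof.
have := cheeger_le_discrepancy g0 scaled_le1 scaled_ones scaled_neq0.
by have := scaled_discrepancy; lra.
Qed.

Lemma bound_ge0 : 0 <= b.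
Proof.
by rewrite -(pmulr_rge0 _ volG_gt0); exact: le_trans cheeger_ge0 cheeger_le_vol_bound.
Qed.

Lemma cheeger_upper (e : R) :
  0 < e < 1 / 2 -> (max_degree g)%:R <= e ^+ 4 * V ->
  cheeger R g * (1 - 2 * e) <= b * (1 + e).
Proof.
move=> e01 degV; have V0 := volG_gt0.
have := bound_ge0; rewrite le_eqVlt => /predU1P[b0|b0].
  have h0 : cheeger R g = 0.
    apply/le_anti; rewrite cheeger_ge0 andbT.
    by apply: le_trans cheeger_le_vol_bound _; rewrite -b0 mulr0.
  by rewrite h0 -b0 !mul0r.
have M0 : 0 < 2 * V * b by rewrite !mulr_gt0.
have := cheeger_le_balanced g0 scaled_le1 scaled_ones e01 degV V0 M0 scaled_discrepancy.
by move=> hV; rewrite -(ler_pM2l V0); lra.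
Qed.

End UpperBound.

(** * The error term *)

Section ErrorTerm.
Variables (R : realType) (G : forall n : nat, simple_graph n).

Definition degree_ratio n : R := (max_degree (G n))%:R / (volG (G n))%:R.

(** With a fourth root e, the bound Delta / vol(G) = e * e^3 on the variance of
    the relative volume leaves a relative error e for the cut and a squared
    relative deviation of order e^3 for the volume. *)
Definition error_scale n : R := Num.sqrt (Num.sqrt (degree_ratio n)).

(** On the first branch (1 + e) / (1 - 2 e) <= 1 + 6 e.  The second one comes
    from the crude bound and is taken for finitely many n only, when
    Delta / vol(G) tends to 0. *)
Definition error_term n : R :=
  if error_scale n < 1 / 4 then 6 * error_scale n else (volG (G n))%:R.

Lemma degree_ratio_ge0 n : 0 <= degree_ratio n.
Proof. by rewrite divr_ge0. Qed.

Lemma error_scale4 n : error_scale n ^+ 4 = degree_ratio n.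
Proof.
by rewrite (exprM _ 2 2) sqr_sqrtr ?sqrtr_ge0 // sqr_sqrtr // degree_ratio_ge0.
Qed.

(** For n >= 1 the factor n^(-2/3) is at most 1. *)
Lemma cvg_degree_ratio :
  (fun n : nat => degree_ratio n / (n%:R `^ (- (2 / 3)))) @ \oo --> (0 : R) ->
  degree_ratio @ \oo --> (0 : R).
Proof.
move=> ratio; apply: (squeeze_cvgr _ (cvg_cst 0) ratio); near=> n.
have n1 : 1 <= n%:R :> R by rewrite ler1n; near: n; exact: nbhs_infty_ge.
rewrite degree_ratio_ge0 /= ler_pdivlMr ?powR_gt0 ?(lt_le_trans ltr01) //.
rewrite ler_piMr ?degree_ratio_ge0 // -[leRHS](powRr0 n%:R) ler_powR //; lra.
Unshelve. all: by end_near. Qed.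

Lemma cvg_error_term : degree_ratio @ \oo --> (0 : R) ->
  error_term @ \oo --> (0 : R).
Proof.
move=> ratio0; have scale0 : error_scale @ \oo --> (0 : R).
  rewrite -(sqrtr0 R) -(sqrtr0 R).
  by do 2 (apply: continuous_cvg; first exact: sqrt_continuous).
have scale6 : (fun n => 6 * error_scale n) @ \oo --> (0 : R).
  by have := cvgM (cvg_cst (6 : R)) scale0; rewrite mulr0; apply.
apply: (squeeze_cvgr _ (cvg_cst 0) scale6); near=> n.
have small : error_scale n < 1 / 4.
  near: n; apply: (cvgr_lt 0 scale0); lra.
by rewrite /error_term small lexx andbT mulr_ge0 ?sqrtr_ge0.
Unshelve. all: by end_near. Qed.

Lemma error_term_dominates n (h b : R) :
  no_isolated (G n) -> (0 < n)%N -> 0 <= b -> h <= (volG (G n))%:R * b ->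
  (forall e, 0 < e < 1 / 2 -> (max_degree (G n))%:R <= e ^+ 4 * (volG (G n))%:R ->
    h * (1 - 2 * e) <= b * (1 + e)) ->
  h <= b * (1 + error_term n).
Proof.
move=> g0 n0 b0 hV hE; have V0 := volG_gt0 R g0 n0.
have deg0 : 0 < (max_degree (G n))%:R :> R.
  rewrite ltr0n; apply: leq_trans (g0 (Ordinal n0)) _.
  by rewrite /max_degree (leq_bigmax (Ordinal n0)).
have e0 : 0 < error_scale n by rewrite !sqrtr_gt0 divr_gt0.
rewrite /error_term; case: ltP => [e4|_]; last by lra.
set e := error_scale n in e0 e4 *.
have := hE e; rewrite error_scale4 divfK ?gt_eqF // lexx => /(_ _ isT) hEe.
have {}hEe : h * (1 - 2 * e) <= b * (1 + e) by apply: hEe; apply/andP; split; lra.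
rewrite -(@ler_pM2r _ (1 - 2 * e)); last by lra.
apply: le_trans hEe _; rewrite -mulrA ler_wpM2l //; nra.
Qed.

End ErrorTerm.

(** * The Cheeger constant *)

Theorem theorem3 (R : realType) (G : forall n : nat, simple_graph n)
    (G_no_isolated : forall n : nat, (1 < n)%N -> no_isolated (G n))
    (G_max_degree :
      (fun n : nat => (max_degree (G n))%:R / (volG (G n))%:R
                      / (n%:R `^ (- (2 / 3)))) @ \oo --> (0 : R)) :
  exists eps : nat -> R,
    eps @ \oo --> (0 : R) /\
    forall n : nat, (1 < n)%N ->
    forall (lam : n.-tuple R) (y : 'I_n -> 'cV[R]_n),
      harmonic_eigensystem (G n) lam y ->
    forall (k : nat) (v : 'cV[R]_n),
      (0 < k <= n.-1)%N ->
      (exists c : 'I_n -> R, v = \sum_(i < n | (0 < i <= k)%N) c i *: y i) ->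
      norm2 (sqrt_deg_mx R (G n) *m v) = 1 ->
      norm_oo v <= 1 / 2 ->
      1 / 2 - (1 - lam`_1) / 2 <= cheeger R (G n)
      /\ cheeger R (G n) <=
         (1 / 2 - (1 - lam`_k) / (2 * norm_oo v ^+ 2 * (volG (G n))%:R))
         * (1 + eps n).
Proof.
exists (@error_term R G); split.
  exact/cvg_error_term/cvg_degree_ratio.
move=> n n1 lam y eigen k v /andP[k0 kn] v_span v_norm _.
have g0 := G_no_isolated n n1; have n0 : (0 < n)%N := ltnW n1.
split; first by have := cheeger_lower g0 eigen n1; lra.
have {kn} kn : (0 < k < n)%N by rewrite k0 -(ltn_predK n1) ltnS.
have [v_ones] := rayleigh_le g0 eigen kn v_span.
have {}v_norm : bform (deg_mx R (G n)) v v = 1.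
  have := congr1 (fun r => r ^+ 2) v_norm.
  rewrite /= expr1n sqr_sqrtr ?sumr_ge0 // => [<-|i _]; last exact: sqr_ge0.
  have /matrixP /(_ ord0 ord0) := sqrt_deg_bform (G n) v v.
  rewrite [RHS]mxE eqxx mulr1n => <-; rewrite [LHS]mxE.
  by apply: eq_bigr => i _; rewrite [_^T _ _]mxE.
rewrite v_norm mulr1 => v_rayleigh; apply: error_term_dominates => //.
- exact: bound_ge0.
- exact: cheeger_le_vol_bound.
- by move=> e; exact: cheeger_upper.
Qed.
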